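(* Let $R$ be a ring. Then the following are equivalent: (1) $R$ is a pseudo BL-ring; (2) $A(R)$ is a pseudo BL-algebra.
   Context: Rings are associative, not necessarily commutative, and not assumed to have an identity unless stated; ''ideal'' means two-sided ideal. A ring $R$ is generated by idempotents if for every $x\in R$ there is an idempotent $e\in R$ with $ex=xe=x$. For ideals $I,J$ of $R$, $I\cdot J$ is the usual product of ideals, $I\rightarrow J:=\{x\in R\mid xI\subseteq J\}$ and $I\rightsquigarrow J:=\{x\in R\mid Ix\subseteq J\}$. A ring $R$ generated by idempotents is a pseudo BL-ring if for all ideals $I,J$: (PBLR-1) $I\cap J=I\cdot(I\rightsquigarrow J)=(I\rightarrow J)\cdot I$; (PBLR-2) $(I\rightarrow J)+(J\rightarrow I)=(I\rightsquigarrow J)+(J\rightsquigarrow I)=R$. $A(R)=\langle Id(R),\wedge,\vee,\otimes,\rightarrow,\rightsquigarrow,\{0\},R\rangle$, where $Id(R)$ is the set of ideals of $R$, $I\wedge J=I\cap J$, $I\vee J=I+J$, $I\otimes J=I\cdot J$, $I\rightarrow J=\{x\in R\mid xI\subseteq J\}$ and $I\rightsquigarrow J=\{x\in R\mid Ix\subseteq J\}$. A pseudo BL-algebra is a structure $(A,\vee,\wedge,\odot,\rightarrow,\rightsquigarrow,0,1)$ such that $(A,\vee,\wedge,0,1)$ is a bounded lattice, $(A,\odot,1)$ is a monoid, and for all $x,y,z\in A$: $x\odot y\le z$ iff $x\le y\rightarrow z$ iff $y\le x\rightsquigarrow z$; $x\wedge y=(x\rightarrow y)\odot x=x\odot(x\rightsquigarrow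 y)$; $(x\rightarrow y)\vee(y\rightarrow x)=(x\rightsquigarrow y)\vee(y\rightsquigarrow x)=1$.
   Formalization: ''Let R be a ring'' is read as ''Let R be a ring generated by idempotents'', the class on which pseudo BL-rings are defined; for arbitrary R, (2) does not imply (1), e.g. R = xW with W the first Weyl algebra in characteristic 0 and x a nonzero nonunit. *)

(* Defs.v *)
From HB Require Import structures.
From mathcomp Require Import all_boot all_order all_algebra.
From mathcomp Require Import boolp classical_sets.

Set Implicit Arguments.
Unset Strict Implicit.
Unset Printing Implicit Defensive.

Import GRing.Theory.
Local Open Scope classical_set_scope.
Local Open Scope ring_scope.

Declare Scope rng_scope.
Delimit Scope rng_scope with rng.
Declare Scope ideal_scope.
Delimit Scope ideal_scope with ideal.

(* MathComp's [pzRingType] has a multiplicative identity, hence a separate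
   structure for rings that need not have one. *)
HB.mixin Record Zmodule_isRng R of GRing.Zmodule R := {
  rng_mul : R -> R -> R;
  rng_mulA : associative rng_mul;
  rng_mulDl : left_distributive rng_mul +%R;
  rng_mulDr : right_distributive rng_mul +%R
}.

#[short(type="rngType")]
HB.structure Definition Rng := { R of Zmodule_isRng R & GRing.Zmodule R }.

Notation "x ** y" := (rng_mul x y) (at level 40, left associativity) : rng_scope.
Local Open Scope rng_scope.

Definition generated_by_idempotents (R : rngType) : Prop :=
  forall x : R, exists e : R, [/\ e ** e = e, e ** x = x & x ** e = x].

Section RngTheory.
Variable R : rngType.
Implicit Types x y : R.

Lemma rng_mul0r x : 0 ** x = 0.
Proof. by apply: (addrI (0 ** x)); rewrite -rng_mulDl !addr0. Qed.

Lemma rng_mulr0 x : x ** 0 = 0.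
Proof. by apply: (addrI (x ** 0)); rewrite -rng_mulDr !addr0. Qed.

Lemma rng_mulrN x y : x ** (- y) = - (x ** y).
Proof. by apply: (addrI (x ** y)); rewrite -rng_mulDr !subrr rng_mulr0. Qed.

Lemma rng_mulNr x y : (- x) ** y = - (x ** y).
Proof. by apply: (addrI (x ** y)); rewrite -rng_mulDl !subrr rng_mul0r. Qed.

Lemma rng_mul_sumr x (I : Type) (s : seq I) (F : I -> R) :
  x ** (\sum_(i <- s) F i) = \sum_(i <- s) x ** F i.
Proof.
by elim: s => [|i s IHs]; rewrite ?big_nil ?rng_mulr0 // !big_cons rng_mulDr IHs.
Qed.

Lemma rng_mul_suml x (I : Type) (s : seq I) (F : I -> R) :
  (\sum_(i <- s) F i) ** x = \sum_(i <- s) F i ** x.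
Proof.
by elim: s => [|i s IHs]; rewrite ?big_nil ?rng_mul0r // !big_cons rng_mulDl IHs.
Qed.

End RngTheory.

Record is_ideal (R : rngType) (I : set R) : Prop := IsIdeal {
  is_ideal0 : I 0;
  is_idealB : forall x y, I x -> I y -> I (x - y);
  is_idealMl : forall r x, I x -> I (r ** x);
  is_idealMr : forall r x, I x -> I (x ** r)
}.

Record ideal (R : rngType) := Ideal {
  ideal_set :> R -> Prop;
  idealP : is_ideal ideal_set
}.

Section IdealOperations.
Variable R : rngType.
Implicit Types I J : ideal R.

Lemma ideal_inj I J : ideal_set I = ideal_set J -> I = J.
Proof.
case: I J => [I hI] [J hJ] /= eqIJ; subst J; congr Ideal; exact: Prop_irrelevance.
Qed.

Lemma ideal0 I : I 0. Proof. exact: is_ideal0 (idealP I). Qed.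
Lemma idealB I x y : I x -> I y -> I (x - y).
Proof. exact: is_idealB (idealP I) x y. Qed.
Lemma idealMl I r x : I x -> I (r ** x).
Proof. exact: is_idealMl (idealP I) r x. Qed.
Lemma idealMr I r x : I x -> I (x ** r).
Proof. exact: is_idealMr (idealP I) r x. Qed.
Lemma idealN I x : I x -> I (- x).
Proof. by move=> Ix; rewrite -sub0r; apply: idealB => //; exact: ideal0. Qed.

Definition ideal_zero_set : set R := [set x | x = 0].
Definition ideal_full_set : set R := setT.
Definition ideal_cap_set I J : set R := [set x | I x /\ J x].
Definition ideal_add_set I J : set R :=
  [set x | exists a b, [/\ I a, J b & x = a + b]].
Definition ideal_mul_set I J : set R :=
  [set x | exists s : seq (R * R),
     (forall p, p \in s -> I p.1 /\ J p.2) /\ x = \sum_(p <- s) p.1 ** p.2].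
Definition ideal_limp_set I J : set R := [set x | forall a, I a -> J (x ** a)].
Definition ideal_rimp_set I J : set R := [set x | forall a, I a -> J (a ** x)].

Lemma ideal_zero_subproof : is_ideal ideal_zero_set.
Proof.
rewrite /ideal_zero_set; split=> //=.
- by move=> x y -> ->; rewrite subr0.
- by move=> r x ->; rewrite rng_mulr0.
- by move=> r x ->; rewrite rng_mul0r.
Qed.

Lemma ideal_full_subproof : is_ideal ideal_full_set.
Proof. by []. Qed.

Lemma ideal_cap_subproof I J : is_ideal (ideal_cap_set I J).
Proof.
rewrite /ideal_cap_set; split=> /=.
- by split; exact: ideal0.
- by move=> x y [Ix Jx] [Iy Jy]; split; exact: idealB.
- by move=> r x [Ix Jx]; split; exact: idealMl.
- by move=> r x [Ix Jx]; split; exact: idealMr.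
Qed.

Lemma ideal_add_subproof I J : is_ideal (ideal_add_set I J).
Proof.
rewrite /ideal_add_set; split=> /=.
- by exists 0, 0; rewrite addr0; split=> //; exact: ideal0.
- move=> _ _ [a [b [Ia Jb ->]]] [c [d [Ic Jd ->]]].
  by exists (a - c), (b - d); split; rewrite ?opprD 1?addrACA //; exact: idealB.
- move=> r _ [a [b [Ia Jb ->]]]; exists (r ** a), (r ** b).
  by rewrite rng_mulDr; split=> //; exact: idealMl.
- move=> r _ [a [b [Ia Jb ->]]]; exists (a ** r), (b ** r).
  by rewrite rng_mulDl; split=> //; exact: idealMr.
Qed.

Lemma ideal_mul_subproof I J : is_ideal (ideal_mul_set I J).
Proof.
rewrite /ideal_mul_set; split=> /=.
- by exists [::]; rewrite big_nil.
- move=> _ _ [s [IJs ->]] [t [IJt ->]].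
  exists (s ++ [seq (- p.1, p.2) | p <- t]); split=> [p|].
    rewrite mem_cat => /orP[/IJs //|/mapP[q /IJt[Iq Jq] ->]].
    by split=> //=; exact: idealN.
  rewrite big_cat big_map /= -sumrN; congr (_ + _).
  by apply: eq_bigr => p _; rewrite rng_mulNr.
- move=> r _ [s [IJs ->]]; exists [seq (r ** p.1, p.2) | p <- s]; split=> [p|].
    by move=> /mapP[q /IJs[Iq Jq] ->]; split=> //=; exact: idealMl.
  rewrite big_map rng_mul_sumr.
  by apply: eq_bigr => p _ /=; rewrite rng_mulA.
- move=> r _ [s [IJs ->]]; exists [seq (p.1, p.2 ** r) | p <- s]; split=> [p|].
    by move=> /mapP[q /IJs[Iq Jq] ->]; split=> //=; exact: idealMr.
  rewrite big_map rng_mul_suml.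
  by apply: eq_bigr => p _ /=; rewrite rng_mulA.
Qed.

Lemma ideal_limp_subproof I J : is_ideal (ideal_limp_set I J).
Proof.
rewrite /ideal_limp_set; split=> /=.
- by move=> a _; rewrite rng_mul0r; exact: ideal0.
- move=> x y xJ yJ a Ia; rewrite rng_mulDl rng_mulNr.
  by apply: idealB; [exact: xJ | exact: yJ].
- by move=> r x xJ a Ia; rewrite -rng_mulA; apply: idealMl; exact: xJ.
- by move=> r x xJ a Ia; rewrite -rng_mulA; apply: xJ; exact: idealMl.
Qed.

Lemma ideal_rimp_subproof I J : is_ideal (ideal_rimp_set I J).
Proof.
rewrite /ideal_rimp_set; split=> /=.
- by move=> a _; rewrite rng_mulr0; exact: ideal0.
- move=> x y xJ yJ a Ia; rewrite rng_mulDr rng_mulrN.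
  by apply: idealB; [exact: xJ | exact: yJ].
- by move=> r x xJ a Ia; rewrite rng_mulA; apply: xJ; exact: idealMr.
- by move=> r x xJ a Ia; rewrite rng_mulA; apply: idealMr; exact: xJ.
Qed.

Definition ideal_zero : ideal R := Ideal ideal_zero_subproof.
Definition ideal_full : ideal R := Ideal ideal_full_subproof.
Definition ideal_cap I J : ideal R := Ideal (ideal_cap_subproof I J).
Definition ideal_add I J : ideal R := Ideal (ideal_add_subproof I J).
Definition ideal_mul I J : ideal R := Ideal (ideal_mul_subproof I J).
Definition ideal_limp I J : ideal R := Ideal (ideal_limp_subproof I J).
Definition ideal_rimp I J : ideal R := Ideal (ideal_rimp_subproof I J).

End IdealOperations.

Bind Scope ideal_scope with ideal.
Notation "I :&: J" := (ideal_cap I J) : ideal_scope.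
Notation "I + J" := (ideal_add I J) : ideal_scope.
Notation "I * J" := (ideal_mul I J) : ideal_scope.
Notation "I ~~> J" := (ideal_limp I J)
  (at level 38, no associativity) : ideal_scope.
Notation "I ~>> J" := (ideal_rimp I J)
  (at level 38, no associativity) : ideal_scope.

Record is_pseudo_BL_ring (R : rngType) : Prop := IsPseudoBLRing {
  pblr_idem : generated_by_idempotents R;
  pblr1_right : forall I J : ideal R, (I :&: J = I * (I ~>> J))%ideal;
  pblr1_left : forall I J : ideal R, (I :&: J = (I ~~> J) * I)%ideal;
  pblr2_left : forall I J : ideal R,
    ((I ~~> J) + (J ~~> I))%ideal = ideal_full R;
  pblr2_right : forall I J : ideal R,
    ((I ~>> J) + (J ~>> I))%ideal = ideal_full R
}.

(* Structures (A, join, meet, mul, limp, rimp, 0, 1), no axioms imposed;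
   [limp] is the arrow [->] and [rimp] the squiggly arrow. *)
Record pBL_struct := PBLStruct {
  pbl_sort :> Type;
  pbl_join : pbl_sort -> pbl_sort -> pbl_sort;
  pbl_meet : pbl_sort -> pbl_sort -> pbl_sort;
  pbl_mul : pbl_sort -> pbl_sort -> pbl_sort;
  pbl_limp : pbl_sort -> pbl_sort -> pbl_sort;
  pbl_rimp : pbl_sort -> pbl_sort -> pbl_sort;
  pbl_bot : pbl_sort;
  pbl_top : pbl_sort
}.

Definition pbl_le (A : pBL_struct) (x y : A) : Prop := pbl_meet x y = x.

Record is_bounded_lattice (A : pBL_struct) : Prop := IsBoundedLattice {
  pbl_joinC : commutative (@pbl_join A);
  pbl_joinA : associative (@pbl_join A);
  pbl_meetC : commutative (@pbl_meet A);
  pbl_meetA : associative (@pbl_meet A);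
  pbl_joinKI : forall x y : A, pbl_meet x (pbl_join x y) = x;
  pbl_meetKU : forall x y : A, pbl_join x (pbl_meet x y) = x;
  pbl_le0x : forall x : A, pbl_le (pbl_bot A) x;
  pbl_lex1 : forall x : A, pbl_le x (pbl_top A)
}.

Record is_mul_monoid (A : pBL_struct) : Prop := IsMulMonoid {
  pbl_mulA : associative (@pbl_mul A);
  pbl_mul1x : left_id (pbl_top A) (@pbl_mul A);
  pbl_mulx1 : right_id (pbl_top A) (@pbl_mul A)
}.

Record is_pseudo_BL_algebra (A : pBL_struct) : Prop := IsPseudoBLAlgebra {
  pbl_lattice : is_bounded_lattice A;
  pbl_monoid : is_mul_monoid A;
  pbl_residl : forall x y z : A,
    pbl_le (pbl_mul x y) z <-> pbl_le x (pbl_limp y z);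
  pbl_residr : forall x y z : A,
    pbl_le (pbl_mul x y) z <-> pbl_le y (pbl_rimp x z);
  pbl_divl : forall x y : A, pbl_meet x y = pbl_mul (pbl_limp x y) x;
  pbl_divr : forall x y : A, pbl_meet x y = pbl_mul x (pbl_rimp x y);
  pbl_prelinl : forall x y : A,
    pbl_join (pbl_limp x y) (pbl_limp y x) = pbl_top A;
  pbl_prelinr : forall x y : A,
    pbl_join (pbl_rimp x y) (pbl_rimp y x) = pbl_top A
}.

Definition ideal_algebra (R : rngType) : pBL_struct :=
  @PBLStruct (ideal R) (@ideal_add R) (@ideal_cap R) (@ideal_mul R)
    (@ideal_limp R) (@ideal_rimp R) (ideal_zero R) (ideal_full R).

(* Main.v *)
(** Every axiom of a pseudo BL-algebra other than divisibility and prelinearity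
    holds in the ideals of any ring generated by idempotents: the idempotents
    are needed only for [R] to be the unit of the product, and associativity of
    the product follows from residuation.  Divisibility and prelinearity are
    (PBLR-1) and (PBLR-2). *)
From mathcomp Require Import all_boot all_order all_algebra.
From mathcomp Require Import boolp classical_sets.
Require Import Defs.

Set Implicit Arguments.
Unset Strict Implicit.
Unset Printing Implicit Defensive.

Import GRing.Theory.
Local Open Scope ring_scope.
Local Open Scope rng_scope.

Section IdealLattice.
Variable R : rngType.
Implicit Types I J K : ideal R.

Definition ideal_sub I J : Prop := forall x, I x -> J x.

Lemma ideal_sub_anti I J : ideal_sub I J -> ideal_sub J I -> I = J.
Proof.
by move=> IJ JI; apply: ideal_inj; apply/funext => x; apply/propext; split;
  [apply: IJ | apply: JI].
Qed.

(** The left side is [pbl_le] in [ideal_algebra R]; this turns the lattice order into inclusion,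
    which can be tested on elements. *)
Lemma ideal_capidl I J : ideal_cap I J = I <-> ideal_sub I J.
Proof.
split=> [<- x [] // | IJ].
by apply: ideal_sub_anti => x; [case | move=> Ix; split=> //; apply: IJ].
Qed.

Lemma idealD I x y : I x -> I y -> I (x + y).
Proof. by move=> Ix Iy; rewrite -[y]opprK; apply: idealB => //; apply: idealN. Qed.

Lemma ideal_add_subl I J : ideal_sub I (ideal_add I J).
Proof. by move=> x Ix; exists x, 0; rewrite addr0; split=> //; apply: ideal0. Qed.

Lemma ideal_add_subr I J : ideal_sub J (ideal_add I J).
Proof. by move=> x Jx; exists 0, x; rewrite add0r; split=> //; apply: ideal0. Qed.

Lemma ideal_add_sub I J K :
  ideal_sub I K -> ideal_sub J K -> ideal_sub (ideal_add I J) K.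
Proof. by move=> IK JK _ [a [b [/IK Ka /JK Kb ->]]]; apply: idealD. Qed.

Lemma mem_ideal_mul I J a b : I a -> J b -> ideal_mul I J (a ** b).
Proof.
move=> Ia Jb; exists [:: (a, b)]; rewrite big_seq1; split=> // p.
by rewrite inE => /eqP ->.
Qed.

(** An ideal is closed under finite sums, so only the generators [a ** b] of the product have to be
    tested. *)
Lemma ideal_mul_sub I J K :
  ideal_sub (ideal_mul I J) K <-> (forall a b, I a -> J b -> K (a ** b)).
Proof.
split=> [IJK a b Ia Jb | IJK _ [s [IJs ->]]].
  by apply: IJK; apply: mem_ideal_mul.
(* [big_seq] keeps [p \in s] as a side condition of the sum, which [IJs] needs. *)
rewrite big_seq; apply: (@big_ind _ K) => [|x y|p /IJs[]].
- exact: ideal0.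
- exact: idealD.
- exact: IJK.
Qed.

(** On generators both sides say that [a ** b] lies in [K] for all [a] in [I] and [b] in [J]. *)
Lemma ideal_mul_sub_limp I J K :
  ideal_sub (ideal_mul I J) K <-> ideal_sub I (ideal_limp J K).
Proof.
rewrite ideal_mul_sub; split=> [IJK x Ix a Ja | IJK x a Ix Ja]; first exact: IJK.
exact: (IJK x).
Qed.

Lemma ideal_mul_sub_rimp I J K :
  ideal_sub (ideal_mul I J) K <-> ideal_sub J (ideal_rimp I K).
Proof.
rewrite ideal_mul_sub; split=> [IJK x Jx a Ia | IJK a x Ia Jx]; first exact: IJK.
exact: (IJK x).
Qed.

Lemma ideal_addC : commutative (@ideal_add R).
Proof.
by move=> I J; apply: ideal_sub_anti; apply: ideal_add_sub;
  (exact: ideal_add_subl || exact: ideal_add_subr).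
Qed.

Lemma ideal_addA : associative (@ideal_add R).
Proof.
move=> I J K; apply: ideal_sub_anti.
  move=> _ [a [_ [Ia [b [c [Jb Kc ->]]] ->]]].
  by rewrite addrA; exists (a + b), c; split=> //; exists a, b.
move=> _ [_ [c [[a [b [Ia Jb ->]]] Kc ->]]].
by rewrite -addrA; exists a, (b + c); split=> //; exists b, c.
Qed.

Lemma ideal_capC : commutative (@ideal_cap R).
Proof. by move=> I J; apply: ideal_sub_anti => x []. Qed.

Lemma ideal_capA : associative (@ideal_cap R).
Proof. by move=> I J K; apply: ideal_sub_anti => x; [case=> ? [] | case=> [[]]]. Qed.

Lemma ideal_addK I J : ideal_cap I (ideal_add I J) = I.
Proof. by apply/ideal_capidl; apply: ideal_add_subl. Qed.

Lemma ideal_capK I J : ideal_add I (ideal_cap I J) = I.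
Proof.
by apply: ideal_sub_anti; [apply: ideal_add_sub => // x [] | apply: ideal_add_subl].
Qed.

Lemma ideal_mulA : associative (@ideal_mul R).
Proof.
move=> I J K; apply: ideal_sub_anti.
  (* Residuation moves [I] to the right-hand side, leaving a single product [J * K] to test on
     generators; no nested sums arise. *)
  apply/ideal_mul_sub_rimp/ideal_mul_sub => b c Jb Kc a Ia.
  by rewrite rng_mulA; do 2!apply: mem_ideal_mul => //.
apply/ideal_mul_sub_limp/ideal_mul_sub => a b Ia Jb c Kc.
by rewrite -rng_mulA; do 2!apply: mem_ideal_mul => //.
Qed.

Lemma ideal_mul1I : generated_by_idempotents R ->
  left_id (ideal_full R) (@ideal_mul R).
Proof.
move=> hR I; apply: ideal_sub_anti => [|x Ix].
  by apply/ideal_mul_sub => a b _; apply: idealMl.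
(* The idempotent [e] fixing [x] writes it as the single product [e ** x], with [e] in [R] and [x]
   in [I]. *)
by have [e [_ <- _]] := hR x; apply: mem_ideal_mul.
Qed.

Lemma ideal_mulI1 : generated_by_idempotents R ->
  right_id (ideal_full R) (@ideal_mul R).
Proof.
move=> hR I; apply: ideal_sub_anti => [|x Ix].
  by apply/ideal_mul_sub => a b Ia _; apply: idealMr.
by have [e [_ _ <-]] := hR x; apply: mem_ideal_mul.
Qed.

Lemma ideal_bounded_lattice : is_bounded_lattice (ideal_algebra R).
Proof.
split.
- exact: ideal_addC.
- exact: ideal_addA.
- exact: ideal_capC.
- exact: ideal_capA.
- exact: ideal_addK.
- exact: ideal_capK.
- by move=> I; apply/ideal_capidl => _ ->; apply: ideal0.
- by move=> I; apply/ideal_capidl.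
Qed.

Lemma ideal_monoid :
  generated_by_idempotents R -> is_mul_monoid (ideal_algebra R).
Proof.
move=> hR; split.
- exact: ideal_mulA.
- exact: ideal_mul1I.
- exact: ideal_mulI1.
Qed.

End IdealLattice.

Theorem proposition3p7 (R : rngType) (hR : generated_by_idempotents R) :
  is_pseudo_BL_ring R <-> is_pseudo_BL_algebra (ideal_algebra R).
Proof.
split=> [[_ divr divl prell prelr] | [_ _ _ _ divl divr prell prelr]].
  (* The operations of [ideal_algebra R] unfold to those on ideals, so [//] settles divisibility and
     prelinearity from the ring axioms. *)
  split=> //.
  - exact: ideal_bounded_lattice.
  - exact: ideal_monoid.
  - by move=> I J K; rewrite /pbl_le /= !ideal_capidl; apply: ideal_mul_sub_limp.
  - by move=> I J K; rewrite /pbl_le /= !ideal_capidl; apply: ideal_mul_sub_rimp.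
(* Conversely, [hR] supplies the idempotents, and the other four fields are the same identities in
   another order. *)
by split.
Qed.
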